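(* Let $K$ be a field, let $m\ge 2$, let $X=(X_{ij})$ be the $m\times m$ matrix of variables of the polynomial ring $K[X_{m\times m}]$, and let $\mathcal{M}_{m-1}$ be the set of $(m-1)$-minors of $X$. Let $\mathcal{N}(\mathcal{M}_{m-1})$ be the Newton polytope of the product of all elements of $\mathcal{M}_{m-1}$, and let $$Q_m=d_mI_m+E_m,\qquad d_m=(m-1)^2-1,$$ where $I_m$ is the $m\times m$ identity matrix and $E_m$ is the $m\times m$ matrix with all entries equal to $1$. Then, up to the action of $G_{m\times m}$, $Q_m$ is the only vertex of $\mathcal{N}(\mathcal{M}_{m-1})$ with full support. In other words, up to the action of $G_{m\times m}$, the only coherent matching of $\mathcal{M}_{m-1}$ involving all the variables is the one given by the initial monomials of the elements of $\mathcal{M}_{m-1}$ with respect to the lexicographic order associated to a total order of the variables of the form $$X_{11}>X_{22}>\cdots>X_{mm}>\cdots\ \text{(the remaining variables in some order)}.$$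
   Context: The Newton polytope of a polynomial is the convex hull of the exponent vectors of the monomials in its support. Exponent vectors of monomials in $K[X_{m\times m}]$ are represented as $m\times m$ matrices with entries in $\mathbb{N}$; such a matrix has full support if all its entries are positive. For a finite list $F_1,\dots,F_s$ of nonzero polynomials, a matching is a list of monomials $X^{a_1},\dots,X^{a_s}$ with $X^{a_i}$ in the support of $F_i$ for every $i$; it is coherent if there is a monomial order such that $X^{a_i}$ is the initial monomial of $F_i$ for every $i$. For homogeneous polynomials, coherent matchings correspond bijectively to the vertices of the Newton polytope of $F_1\cdots F_s$ by sending a coherent matching to the exponent vector of the product of its monomials. The group $G_{m\times m}$ is the semidirect product of $S_m\times S_m$ with the cyclic group of order $2$; it acts on $K[X_{m\times m}]$, with the two factors $S_m$ permuting the rows and the columns of $X$ and the cyclic group of order $2$ transposing $X$. This action preserves $\mathcal{M}_{m-1}$ up to sign, and so it induces actions on the coherent matchings of $\mathcal{M}_{m-1}$ and on $\mathcal{N}(\mathcal{M}_{m-1})$ (permuting rows and columns of exponent matrices and transposing them). *)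

(* Defs.v *)
From HB Require Import structures.
From mathcomp Require Import all_boot all_order all_algebra all_fingroup.
From mathcomp Require Import reals.
From mathcomp Require Import mpoly.

Set Implicit Arguments.
Unset Strict Implicit.
Unset Printing Implicit Defensive.

Import Order.TTheory GRing.Theory Num.Theory.

Local Open Scope ring_scope.

Definition total_order (T : eqType) (le : rel T) : Prop :=
  [/\ reflexive le, antisymmetric le, transitive le & total le].

Section Polytopes.

Variables (R : realType) (n : nat).
Implicit Types (S P : 'rV[R]_n -> Prop) (v : 'rV[R]_n).

Definition convex_hull S v : Prop :=
  exists (k : nat) (c : 'I_k -> R) (y : 'I_k -> 'rV[R]_n),
    [/\ forall i, 0 <= c i,
        \sum_(i < k) c i = 1,
        forall i, S (y i)
      & v = \sum_(i < k) c i *: y i].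

(* A vertex is a zero-dimensional face: [set v] is the set of maximizers on P
   of the linear functional with coefficient vector w. *)
Definition vertex P v : Prop :=
  P v /\
  exists w : 'rV[R]_n, forall u, P u -> u <> v ->
    \sum_(k < n) w ord0 k * u ord0 k < \sum_(k < n) w ord0 k * v ord0 k.

Definition expvec (a : 'X_{1..n}) : 'rV[R]_n := \row_(k < n) (a k)%:R.

Definition newton_polytope (K : fieldType) (f : {mpoly K[n]}) :
    'rV[R]_n -> Prop :=
  convex_hull (fun v => exists2 a, a \in msupp f & v = expvec a).

End Polytopes.

Section Matchings.

Variable n : nat.

Definition monomial_order (r : rel 'X_{1..n}) : Prop :=
  [/\ total_order r,
      forall a, r 0%MM a
    & forall a b c, r a b -> r (a + c)%MM (b + c)%MM].

Variable K : fieldType.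

Definition initial_monomial (r : rel 'X_{1..n}) (f : {mpoly K[n]})
    (a : 'X_{1..n}) : Prop :=
  a \in msupp f /\ {in msupp f, forall b, r b a}.

Definition matching (I : finType) (F : I -> {mpoly K[n]})
    (a : I -> 'X_{1..n}) : Prop :=
  forall i, a i \in msupp (F i).

Definition coherent (I : finType) (F : I -> {mpoly K[n]})
    (a : I -> 'X_{1..n}) : Prop :=
  matching F a /\
  exists2 r : rel 'X_{1..n},
    monomial_order r & forall i, initial_monomial r (F i) (a i).

Definition involves_all_variables (I : finType) (a : I -> 'X_{1..n}) : Prop :=
  forall k : 'I_n, exists i, (0 < a i k)%N.

(* [le x y] reads "the variable 'X_x is at most the variable 'X_y". *)
Definition lex_order (le : rel 'I_n) : rel 'X_{1..n} :=
  fun a b => (a == b) ||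
    [exists x, (a x < b x)%N &&
       [forall y, (y != x) && le x y ==> (a y == b y)]].

End Matchings.

Section GenericMatrix.

Variable m : nat.

(* The polynomial ring in the m x m entries is {mpoly K[m * m]}; the variable
   in row i and column j is the one of index [mxvec_index i j]. *)
Definition genericX (K : fieldType) : 'M[{mpoly K[m * m]}]_m :=
  \matrix_(i, j) 'X_(mxvec_index i j).

(* The (m-1)-minors, indexed by the deleted row and column; for m >= 2 they
   are pairwise distinct, so this family enumerates the set of them. *)
Definition submaximal_minor (K : fieldType) (p : 'I_m * 'I_m) :
    {mpoly K[m * m]} :=
  \det (row' p.1 (col' p.2 (genericX K))).

Definition expmx (a : 'X_{1..m * m}) : 'M[nat]_m :=
  \matrix_(i, j) a (mxvec_index i j).

Definition full_support (R : realType) (A : 'M[R]_m) : Prop :=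
  forall i j, 0 < A i j.

Definition Qmx : 'M[nat]_m := ((m - 1) ^ 2 - 1)%N%:M + const_mx 1%N.

(* X_11 > X_22 > ... > X_mm > all the off-diagonal variables. *)
Definition diagonal_first (le : rel 'I_(m * m)) : Prop :=
  [/\ total_order le,
      forall i j : 'I_m, (i < j)%N -> le (mxvec_index j j) (mxvec_index i i)
    & forall i j k : 'I_m, i != j -> le (mxvec_index i j) (mxvec_index k k)].

End GenericMatrix.

Section GroupG.

Variable m : nat.

Definition swap_perms (x : 'S_m * 'S_m) (e : 'Z_2) : 'S_m * 'S_m :=
  if e == 0 then x else (x.2, x.1).

Lemma swap_perms_is_action : is_action [set: 'Z_2] swap_perms.
Proof.
split=> [e [s t] [s' t'] | [s t] e f _ _].
  by rewrite /swap_perms; case: (e == 0) => //= -[-> ->].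
by case: e => [[|[|e]] He] //; case: f => [[|[|f]] Hf].
Qed.

Canonical swap_action := Action swap_perms_is_action.

Lemma swap_is_groupAction :
  is_groupAction [set: 'S_m * 'S_m] swap_action.
Proof.
move=> e _; rewrite /= inE; apply/andP; split.
  by apply/subsetP=> x _; rewrite inE.
apply/morphicP=> x y _ _; rewrite !actpermE /= /swap_perms.
by case: (e == 0).
Qed.

Canonical swap_groupAction := GroupAction swap_is_groupAction.

(* The semidirect product of S_m x S_m with the cyclic group of order 2, whose
   generator exchanges the two factors. *)
Definition Gmm : finGroupType := sdprod_groupType swap_groupAction.

(* The pair (e, (s, t)) is the product of e and (s, t); actions are on the
   right, so e acts first, as a transposition when e != 0. *)
Definition pos_act_fun (p : 'I_m * 'I_m) (g : Gmm) : 'I_m * 'I_m :=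
  let: (e, (s, t)) := pair_of_sd g in
  let q := if e == 0 then p else (p.2, p.1) in
  (s q.1, t q.2).

Lemma pos_act_fun1 : pos_act_fun^~ 1%g =1 id.
Proof. by case=> i j; rewrite /pos_act_fun /= !perm1. Qed.

Lemma pos_act_funM p : act_morph pos_act_fun p.
Proof.
case: p => i j [[e [s t]] eP] [[f [s' t']] fP]; rewrite /pos_act_fun /=.
rewrite /swap_perms.
by case: e {eP} => [[|[|e]] He] //; case: f {fP} => [[|[|f]] Hf] //=;
   rewrite !permM.
Qed.

Definition pos_act : {action Gmm &-> 'I_m * 'I_m} :=
  TotalAction pos_act_fun1 pos_act_funM.

(* The entry of A at position p is moved to position pos_act p g. *)
Definition mx_act (T : Type) (A : 'M[T]_m) (g : Gmm) : 'M[T]_m :=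
  \matrix_(i, j) (let q := pos_act (i, j) g^-1%g in A q.1 q.2).

(* Substituting X_(pos_act p g) for each variable X_p maps the minor with
   deleted position p to the minor with deleted position pos_act p g, up to
   sign. Hence the induced action on matchings, here given by their exponent
   matrices, also moves the index. *)
Definition match_act (a : 'I_m * 'I_m -> 'M[nat]_m) (g : Gmm) :
    'I_m * 'I_m -> 'M[nat]_m :=
  fun p => mx_act (a (pos_act p g^-1%g)) g.

End GroupG.

(* Main.v *)
Require Import Defs.
From HB Require Import structures.
From mathcomp Require Import all_boot all_order all_algebra all_fingroup.
From mathcomp Require Import reals zify.
From mathcomp Require Import mpoly.

Set Implicit Arguments.
Unset Strict Implicit.
Unset Printing Implicit Defensive.

Import Order.TTheory GRing.Theory Num.Theory.

Local Open Scope ring_scope.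

(* Relabel the columns so that the diagonal is the optimal term of the full
   determinant.  Weighing every arrow i -> j by x_ij - x_ii, all cycles are then
   nonpositive, and the optimal term of the minor without row p and column q
   consists of an optimal path from q to p and of diagonal entries elsewhere.  A
   piece of an optimal path is optimal, so an off-diagonal variable x_ij occurs in
   some optimal term only if the single arrow i -> j is the optimal path from i to
   j, i.e. only if x_ij * prod_(k != i, j) x_kk is the optimal term of the minor
   without row j and column i.  If all variables occur, this determines the
   matching.  A vertex w-maximal for a weight w is handled by refining w to a
   translation-invariant total order on monomials. *)

(** * Redistributing the arrows of two permutations *)

Section Exchange.

Variable T : finType.

(* C is the segment of the f-orbit of p that ends just before q, or the whole
   orbit if it avoids q. *)
Lemma exchange_set (f : {perm T}) (p q : T) : p != q ->
  exists C : {set T},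
    [/\ p \in C, q \notin C & f @: C = C \/ f @: C = q |: C :\ p].
Proof.
move=> neq_pq; pose e := [rel k l | (l == f k) && (l != q)].
pose C := [set k | connect e p k]; exists C.
have pC : p \in C by rewrite inE connect0.
have qC : q \notin C.
  rewrite inE; apply/connectP=> -[s].
  elim/last_ind: s => [|s k _]; first by
    move=> _ /eqP; rewrite eq_sym (negPf neq_pq).
  rewrite rcons_path last_rcons => /andP[_ /andP[_ kq]] qk.
  by rewrite qk eqxx in kq.
have fC k : k \in C -> f k != q -> f k \in C.
  rewrite !inE => pk fkq; apply: (connect_trans pk).
  by apply: connect1; rewrite /= eqxx.
have Cf k : k \in C -> k != p -> k \in f @: C.
  rewrite inE => /connectP[s].
  elim/last_ind: s k => [|s l _] k; first by move=> _ -> /eqP.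
  rewrite rcons_path last_rcons => /andP[ps /andP[/eqP lf _]] -> _.
  by rewrite lf; apply: imset_f; rewrite inE; apply/connectP; exists s.
split=> //; have [qfC|qfC] := boolP (q \in f @: C); [right | left].
  (* One inclusion suffices: [p] leaves and [q] enters, so both sides have the cardinality of
     [C]. *)
  apply/esym/eqP; rewrite eqEcard; apply/andP; split.
    apply/subsetP=> k; rewrite !inE => /orP[/eqP->//|/andP[kp kC]].
    by apply: Cf => //; rewrite inE.
  rewrite card_imset; last exact: perm_inj.
  by rewrite cardsU1 in_setD1 (negPf qC) andbF (cardsD1 p C) pC.
apply/eqP; rewrite eqEcard card_imset ?leqnn ?andbT; last exact: perm_inj.
apply/subsetP=> _ /imsetP[k kC ->]; apply: fC => //.
by apply: contraNneq qfC => <-; apply: imset_f.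
Qed.

(** A collision could only occur between [s] on [C] and [t] off [C], but [t] maps only [C] into the
    common image. *)
Lemma patch_perm (s t : {perm T}) (C : {set T}) : s @: C = t @: C ->
  exists u : {perm T}, forall k, u k = if k \in C then s k else t k.
Proof.
move=> stC; pose u k := if k \in C then s k else t k.
suff u_inj : injective u by exists (perm u_inj) => k; rewrite permE.
have mixed k l : k \in C -> l \notin C -> s k <> t l.
  move=> kC lC skl; have : s k \in t @: C by rewrite -stC imset_f.
  by rewrite skl => /imsetP[l' l'C /perm_inj ll']; rewrite ll' l'C in lC.
rewrite /u => k l; case: ifPn => kC; case: ifPn => lC; try exact: perm_inj.
  by move/mixed=> /(_ kC lC).
by move/esym/mixed=> /(_ lC kC).
Qed.

(** Used to separate rows [p] and [q]: [u] follows [s] at [p], and [v] follows [s] at [q]. If the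
    segment from [p] runs into [q], the images of [C] under [s] and [t] differ, and exchanging the
    values of [t] at [p] and [q] makes them equal. *)
Lemma exchange (s t : {perm T}) (p q : T) : p != q ->
  exists (t' u v : {perm T}) (C : {set T}),
    [/\ t' = t \/ t' = (tperm p q * t)%g, p \in C, q \notin C,
        forall k, u k = if k \in C then s k else t' k
      & forall k, v k = if k \in C then t' k else s k].
Proof.
move=> neq_pq; have [C [pC qC fC]] := exchange_set (s * t^-1)%g neq_pq.
have [t' [t't st'C]] : exists t' : {perm T},
    (t' = t \/ t' = (tperm p q * t)%g) /\ s @: C = t' @: C.
  have sE : s =1 t \o (s * t^-1)%g by move=> k; rewrite /= permM permKV.
  case: fC => fC; [exists t | exists (tperm p q * t)%g]; split; try by auto.
    by rewrite (eq_imset _ sE) imset_comp fC.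
  rewrite (eq_imset _ sE) imset_comp fC.
  have tE : (tperm p q * t)%g =1 t \o tperm p q by move=> k; rewrite permM.
  rewrite (eq_imset _ tE) imset_comp; congr (_ @: _).
  rewrite -{2}(setD1K pC) imsetU1 tpermL.
  congr (_ |: _); rewrite -[LHS]imset_id; apply: eq_in_imset => k.
  rewrite !inE => /andP[kp kC]; rewrite tpermD // 1?eq_sym //.
  by apply: contraNneq qC => <-.
have [u uE] := patch_perm st'C; have [v vE] := patch_perm (esym st'C).
by exists t', u, v, C.
Qed.

End Exchange.

(** * Total orders on exponent vectors that are compatible with addition *)

Section TranslationInvariantOrder.

Variables (n : nat) (r : rel 'X_{1..n}).

(** A monomial order without the clause that [0%MM] is least, so as to cover orders refining a
    weight with negative entries. *)
Definition translation_invariant : Prop :=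
  total_order r /\ forall a b c, r a b -> r (a + c)%MM (b + c)%MM.

Hypothesis r_inv : translation_invariant.

Lemma ti_anti a b : r a b -> r b a -> a = b.
Proof. by case: r_inv => -[_ anti _ _] _ ab ba; apply: anti; rewrite ab. Qed.

Lemma ti_trans : transitive r. Proof. by case: r_inv => -[]. Qed.

Lemma ti_add a b c d : r a b -> r c d -> r (a + c)%MM (b + d)%MM.
Proof.
case: r_inv => _ r_add ab cd; apply: (ti_trans (r_add _ _ c ab)).
by rewrite ![(b + _)%MM]addmC; apply: r_add.
Qed.

Lemma ti_add2r a b c : r (a + c)%MM (b + c)%MM -> r a b.
Proof.
case: r_inv => -[_ _ _ tot] r_add; case/orP: (tot a b) => // ba abc.
by have := ti_anti abc (r_add _ _ c ba) => /addIm ->; case/orP: (tot b b).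
Qed.

(** The identity says that the formal differences [c - d] and [a - b] agree. Later inequalities are
    sums of known ones, transported by such an identity, which is checked coordinatewise. *)
Lemma ti_shift a b c d : r a b -> (c + b = d + a)%MM -> r c d.
Proof.
case: r_inv => -[rr _ _ _] _ ab cbda; apply: (@ti_add2r _ _ a).
by rewrite -cbda; apply: ti_add.
Qed.

End TranslationInvariantOrder.

(** * Optimal terms of the minors as optimal paths *)

Section TropicalAdjugate.

Variables (n : nat) (r : rel 'X_{1..n}) (T : finType).
Variable x : T -> T -> 'X_{1..n}.
Hypothesis r_inv : translation_invariant r.

(* Weights are monomials, compared by r and added as exponent vectors; [cowt p]
   omits row p. *)
Definition wt (s : {perm T}) : 'X_{1..n} :=
  \big[mnm_add/0%MM]_k x k (s k).

Definition cowt (p : T) (s : {perm T}) : 'X_{1..n} :=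
  \big[mnm_add/0%MM]_(k | k != p) x k (s k).

Lemma wt_cowt p s : wt s = (x p (s p) + cowt p s)%MM.
Proof. by rewrite /wt (bigD1 p). Qed.

Lemma wt_patch (s t u v : {perm T}) (C : {set T}) :
  (forall k, u k = if k \in C then s k else t k) ->
  (forall k, v k = if k \in C then t k else s k) ->
  (wt s + wt t = wt u + wt v)%MM.
Proof.
move=> uE vE; rewrite /wt -!big_split; apply: eq_bigr => k _.
by rewrite uE vE; case: ifP => // _; exact: addmC.
Qed.

(** The two entries lost in the exchange are added on the left, which avoids truncated
    subtraction. *)
Lemma wt_tperm p q (s : {perm T}) : p != q ->
  (wt (tperm p q * s)%g + x p (s p) + x q (s q)
   = wt s + x p (s q) + x q (s p))%MM.
Proof.
move=> neq_pq; have neq_qp : q != p by rewrite eq_sym.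
rewrite /wt (bigD1 p) // (bigD1 q) //= !permM tpermL tpermR.
rewrite [in RHS](bigD1 p) // (bigD1 q) //=.
rewrite (eq_bigr (fun k => x k (s k))) => [|k /andP[kp kq]].
  by apply/mnmP=> c; rewrite !mnmDE; lia.
by rewrite permM tpermD 1?eq_sym.
Qed.

Variable opt : T -> T -> {perm T}.
Hypothesis wt_id : forall s, r (wt s) (wt 1%g).
Hypothesis optE : forall p q, opt p q p = q.
Hypothesis opt_max : forall p s, r (cowt p s) (cowt p (opt p (s p))).
Hypothesis opt_uniq :
  forall p (s : {perm T}), r (cowt p (opt p (s p))) (cowt p s) -> s = opt p (s p).

(** The tropical cofactor at [(p, q)]; after normalization by the diagonal, the weight of an optimal
    path from [q] to [p]. *)
Definition opt_val p q := cowt p (opt p q).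

Lemma cowt_opt p q (s : {perm T}) : s p = q -> r (cowt p s) (opt_val p q).
Proof. by move=> <-; apply: opt_max. Qed.

(** Among permutations fixing [p], [wt] and [cowt p] differ by the constant [x p p], so the identity
    is optimal for both. *)
Lemma opt_diag p : opt p p = 1%g.
Proof.
apply/esym; rewrite -{2}(perm1 p); apply: opt_uniq; rewrite perm1.
apply: (ti_shift r_inv (wt_id (opt p p))).
by rewrite !(wt_cowt p) optE perm1; apply/mnmP=> c; rewrite !mnmDE; lia.
Qed.

(* An optimal path l -> q followed by an optimal path q -> p is at most an optimal
   path l -> p. *)
Lemma opt_val_triangle p q l :
  r (opt_val p q + opt_val q l)%MM (opt_val p l + opt_val q q)%MM.
Proof.
have r_refl : reflexive r by by case: r_inv => -[].
have [->|neq_pq] := eqVneq p q; first by rewrite addmC; apply: r_refl.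
have neq_qp : q != p by rewrite eq_sym.
have [t' [u [v [C [t't pC /negPf qC uE vE]]]]] :=
  exchange (opt p q) (opt q l) neq_pq.
have I1 := wt_patch uE vE.
have := uE q; have := uE p; have := vE q; have := vE p.
rewrite {}pC {}qC !optE => vp vq up uq.
have Es := wt_cowt p (opt p q); rewrite optE in Es.
have Et := wt_cowt q (opt q l); rewrite optE in Et.
have Ed := wt_cowt q 1%g; rewrite perm1 in Ed.
rewrite /opt_val opt_diag; case: t't vp vq up uq I1 =>
  {t' uE vE} -> vp vq up uq I1.
(* [u] sends [p] to [q] and [q] to [l]; exchanging these values gives a competitor for [opt p l]
   that fixes [q], while [v] is compared with the identity. *)
- have I2 := wt_tperm u neq_pq.
  have le1 : r (cowt p (tperm p q * u)%g) (opt_val p l).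
    by apply: cowt_opt; rewrite permM tpermL uq optE.
  have E1 := wt_cowt p (tperm p q * u)%g.
  rewrite permM tpermL in E1.
  apply: (ti_shift r_inv (ti_add r_inv le1 (wt_id v))).
  move: E1 I2; rewrite uq up optE => E1 I2.
  apply/mnmP=> c; move/mnmP/(_ c): Es; move/mnmP/(_ c): Et.
  move/mnmP/(_ c): Ed; move/mnmP/(_ c): E1; move/mnmP/(_ c): I2.
  by move/mnmP/(_ c): I1; rewrite !mnmDE /opt_val; lia.
(* Here [v] itself sends [p] to [l], and [u] with its values at [p] and [q] exchanged fixes [q]. *)
- have I2 := wt_tperm (opt q l) neq_pq.
  have I3 := wt_tperm u neq_pq.
  rewrite permM tpermL optE in vp.
  rewrite permM tpermR in uq.
  have le1 : r (cowt p v) (opt_val p l) by apply: cowt_opt.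
  have le2 : r (cowt q (tperm p q * u)%g) (opt_val q q).
    by apply: cowt_opt; rewrite permM tpermR.
  have E1 := wt_cowt p v; have E2 := wt_cowt q (tperm p q * u)%g.
  rewrite permM tpermR up in E2; rewrite vp in E1.
  apply: (ti_shift r_inv (ti_add r_inv le1 le2)).
  move: I2 I3; rewrite up uq optE /opt_val opt_diag => I2 I3.
  apply/mnmP=> c; move/mnmP/(_ c): Es; move/mnmP/(_ c): Et.
  move/mnmP/(_ c): E1; move/mnmP/(_ c): E2; move/mnmP/(_ c): I2.
  by move/mnmP/(_ c): I1; move/mnmP/(_ c): I3; rewrite !mnmDE; lia.
Qed.

(* The optimal path q -> p cut at its arrow (i, j). *)
Lemma opt_val_split p q i j : p != i -> i != j -> opt p q i = j ->
  r (opt_val p q + wt 1%g)%MM (opt_val i q + opt_val p j + x i j)%MM.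
Proof.
move=> neq_pi neq_ij optij.
have [t' [u [v [C [t't pC /negPf iC uE vE]]]]] := exchange (opt p q) 1 neq_pi.
have I1 := wt_patch uE vE.
have := uE i; have := uE p; have := vE i; have := vE p.
rewrite {}pC {}iC !optE optij => vp vi up ui.
have Es := wt_cowt p (opt p q); rewrite optE in Es.
case: t't vp vi up ui I1 => {t' uE vE} -> vp vi up ui I1.
(* Comparing [v] with the identity makes [u] at least as good as [opt p q]; uniqueness identifies
   them, although [u] fixes [i] and [opt p q] moves it. *)
- suff uo : u = opt p q.
    by rewrite -uo ui perm1 in optij; rewrite optij eqxx in neq_ij.
  have le1 : r (opt_val p q) (cowt p u).
    apply: (ti_shift r_inv (wt_id v)).
    have E1 := wt_cowt p u; rewrite up in E1.
    apply/mnmP=> c; move/mnmP/(_ c): Es; move/mnmP/(_ c): E1.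
    by move/mnmP/(_ c): I1; rewrite !mnmDE /opt_val; lia.
  by rewrite -up; apply: opt_uniq; rewrite up.
(* [u] carries the piece from [q] to [i], and [v] the arrow [(i, j)] followed by the piece from [j]
   to [p]. Exchanging values at [p] and [i] turns them into competitors for [opt i q] and
   [opt p j]. *)
- rewrite mulg1 in vp up ui I1; rewrite tpermL in vp; rewrite tpermR in ui.
  have I2 := wt_tperm 1%g neq_pi; rewrite mulg1 !perm1 in I2.
  have I3 := wt_tperm u neq_pi; rewrite up ui in I3.
  have I4 := wt_tperm v neq_pi; rewrite vp vi in I4.
  have le1 : r (cowt p (tperm p i * v)%g) (opt_val p j).
    by apply: cowt_opt; rewrite permM tpermL.
  have le2 : r (cowt i (tperm p i * u)%g) (opt_val i q).
    by apply: cowt_opt; rewrite permM tpermR.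
  have E1 := wt_cowt p (tperm p i * v)%g; have E2 := wt_cowt i (tperm p i * u)%g.
  rewrite permM tpermL vi in E1; rewrite permM tpermR up in E2.
  apply: (ti_shift r_inv (ti_add r_inv le2 le1)).
  apply/mnmP=> c; move/mnmP/(_ c): Es; move/mnmP/(_ c): E1; move/mnmP/(_ c): E2.
  move/mnmP/(_ c): I1; move/mnmP/(_ c): I2; move/mnmP/(_ c): I3.
  by move/mnmP/(_ c): I4; rewrite !mnmDE /opt_val; lia.
Qed.

(** Adding the splitting inequality to the triangle inequalities through [i] and through [j] cancels
    every value involving [p] or [q]. What remains bounds [opt_val j i] by the single arrow
    [(i, j)], and uniqueness concludes. *)
Lemma opt_used p q i j : p != i -> i != j -> opt p q i = j ->
  opt j i = tperm i j.
Proof.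
move=> neq_pi neq_ij optij; apply/esym.
rewrite -{2}(tpermR i j); apply: opt_uniq; rewrite tpermR -/(opt_val j i).
have le := ti_add r_inv
  (ti_add r_inv (opt_val_triangle p i q) (opt_val_triangle p j i))
  (opt_val_split neq_pi neq_ij optij).
apply: (ti_shift r_inv le).
have I1 := wt_tperm 1%g neq_ij; rewrite mulg1 !perm1 in I1.
have E1 := wt_cowt j (tperm i j); rewrite tpermR in E1.
have E2 := wt_cowt i 1%g; rewrite perm1 in E2.
have E3 := wt_cowt j 1%g; rewrite perm1 in E3.
apply/mnmP=> c; move/mnmP/(_ c): I1; move/mnmP/(_ c): E1; move/mnmP/(_ c): E2.
by move/mnmP/(_ c): E3; rewrite /opt_val !opt_diag !mnmDE; lia.
Qed.

Hypothesis all_used :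
  forall i j, i != j -> exists p q, p != i /\ opt p q i = j.

Lemma opt_tperm p q : opt p q = tperm p q.
Proof.
have [->|neq_pq] := eqVneq p q; first by rewrite opt_diag tperm1.
have neq_qp : q != p by rewrite eq_sym.
have [k [l [kq opt_kl]]] := all_used neq_qp.
by rewrite (opt_used kq neq_qp opt_kl) tpermC.
Qed.

End TropicalAdjugate.

(** * Initial monomials of products *)

Section StrictInitialMonomials.

Variables (n : nat) (K : fieldType) (lt : rel 'X_{1..n}).
Implicit Types f g : {mpoly K[n]}.

(** [lt] is not assumed total: it stands both for the strict part of a total order and for the
    comparison of weights, where distinct monomials may tie. *)
Definition strict_initial f a : Prop :=
  a \in msupp f /\ {in msupp f, forall b, b != a -> lt b a}.

Hypothesis lt_irr : irreflexive lt.
Hypothesis lt_trans : transitive lt.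
Hypothesis lt_add2r : forall a b c, lt a b -> lt (a + c)%MM (b + c)%MM.

(** The second alternative, with irreflexivity, shows that [a + b] arises from only one pair of
    exponents, so that its coefficient in [f * g] cannot cancel. *)
Lemma strict_initial_lt_add f g a b c d :
    strict_initial f a -> strict_initial g b ->
    c \in msupp f -> d \in msupp g -> (c + d)%MM != (a + b)%MM \/ c != a ->
  lt (c + d)%MM (a + b)%MM.
Proof.
move=> [_ fa] [_ gb] cf dg.
have add_d e : lt (e + d)%MM (e + b)%MM \/ d = b.
  have [->|db] := eqVneq d b; [by right | left].
  by rewrite ![(e + _)%MM]addmC; apply/lt_add2r/gb.
have [->|ca] := eqVneq c a.
  by case: (add_d a) => [//|->]; rewrite !eqxx; case.
have lt_ca : lt (c + d)%MM (a + d)%MM by apply/lt_add2r/fa.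
by case: (add_d a) => [/(lt_trans lt_ca)//|<-].
Qed.

Lemma strict_initial_mul f g a b :
  strict_initial f a -> strict_initial g b -> strict_initial (f * g) (a + b)%MM.
Proof.
move=> fa gb; have [af _] := fa; have [bg _] := gb; split; last first.
  move=> e /msuppM_le/allpairsP[[c d] [/= cf dg ->]] neq.
  by apply: (strict_initial_lt_add fa gb) => //; left.
suff fgab : (f * g)@_(a + b) = f@_a * g@_b.
  by rewrite mcoeff_msupp fgab mulf_neq0 // -mcoeff_msupp.
rewrite {1}[f]mpolyE mulr_suml raddf_sum /= (bigD1_seq a) ?msupp_uniq //=.
rewrite -scalerAl mcoeffZ ['X_[a] * g]mulrC mcoeffMX.
rewrite big1_seq ?addr0 // => c /andP[ca cf].
rewrite -scalerAl mcoeffZ; apply/eqP; rewrite mulf_eq0; apply/orP; right.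
rewrite mcoeff_eq0; apply/negP => /msuppM_le/allpairsP[[c' d]].
rewrite /= msuppX inE => -[/eqP -> dg abcd].
have := strict_initial_lt_add fa gb cf dg (or_intror ca).
by rewrite abcd lt_irr.
Qed.

Lemma strict_initial_prod (I : finType) (F : I -> {mpoly K[n]})
    (a : I -> 'X_{1..n}) :
    (forall i, strict_initial (F i) (a i)) ->
  strict_initial (\prod_i F i) (\big[mnm_add/0%MM]_i a i).
Proof.
move=> Fa; elim/big_ind2: _ => [|f b g c|//]; last exact: strict_initial_mul.
by split=> [|b]; rewrite msupp1 inE // => ->.
Qed.

End StrictInitialMonomials.

Lemma initial_monomial_strict (n : nat) (K : fieldType) (r : rel 'X_{1..n})
    (f : {mpoly K[n]}) (a : 'X_{1..n}) :
  reflexive r ->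
  initial_monomial r f a <-> strict_initial (fun a b => (a != b) && r a b) f a.
Proof.
move=> r_refl; split=> -[af fa]; split=> // b bf.
  by move=> ->; rewrite fa.
by have [->|/(fa b bf)/andP[]] := eqVneq b a.
Qed.

(** * Lexicographic orders are monomial orders *)

Section LexOrder.

Variables (n : nat) (le : rel 'I_n).
Hypothesis le_total : total_order le.

Lemma lex_orderP (a b : 'X_{1..n}) :
  reflect (a = b \/ exists x, (a x < b x)%N /\
             forall y, y != x -> le x y -> a y = b y)
    (lex_order le a b).
Proof.
apply: (iffP orP) => -[ab|].
- by left; apply/eqP.
- case/existsP=> x /andP[lt_x /forallP eq_x]; right; exists x; split=> // y yx xy.
  by have := eq_x y; rewrite yx xy => /eqP.
- by left; apply/eqP.
case=> x [lt_x eq_x]; right; apply/existsP; exists x; rewrite lt_x.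
by apply/forallP=> y; apply/implyP=> /andP[yx xy]; apply/eqP/eq_x.
Qed.

Lemma largest_difference (a b : 'X_{1..n}) : a != b ->
  exists x, a x != b x /\ forall y, y != x -> le x y -> a y = b y.
Proof.
case: le_total => le_refl le_anti le_trans le_tot neq_ab.
have [x0 x0P] : exists x0, a x0 != b x0.
  apply/existsP; apply: contraNT neq_ab; rewrite negb_exists => /forallP eq_ab.
  by apply/eqP/mnmP=> x; apply/eqP; have := eq_ab x; rewrite negbK.
have ge_refl : reflexive (fun x y => le y x) by move=> x; apply: le_refl.
have ge_trans : transitive (fun x y => le y x).
  by move=> y x z yx zy; apply: le_trans yx.
have ge_tot : total (fun x y => le y x) by move=> x y; apply: le_tot.
have [x xP x_max] := @extremumP _ _ _ x0 (fun x => a x != b x) id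
  ge_refl ge_trans ge_tot x0P.
exists x; split=> // y yx xy; apply/eqP/negPn/negP=> /x_max /= yx'.
by move: yx; rewrite (le_anti x y) ?eqxx // xy.
Qed.

Lemma lex_order_monomial : monomial_order (lex_order le).
Proof.
have [le_refl le_anti le_trans le_tot] := le_total; split.
- split.
  + by move=> a; apply/lex_orderP; left.
  + move=> a b /andP[/lex_orderP[//|[x [lt_x eq_x]]] /lex_orderP[//|[y [lt_y eq_y]]]].
    have [xy|neq_xy] := eqVneq x y; first by rewrite xy ltnNge ltnW in lt_x.
    have /orP[xy|yx] := le_tot x y.
      by rewrite (eq_x y) ?ltnn 1?eq_sym in lt_y.
    by rewrite (eq_y x) ?ltnn in lt_x.
  + move=> b a c /lex_orderP[->//|[x [lt_x eq_x]]].
    case/lex_orderP=> [<-|[y [lt_y eq_y]]]; apply/lex_orderP; right; first by exists x.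
    (* The larger of the two deciding variables decides between [a] and [c]. *)
    have [xy|neq_xy] := eqVneq x y.
      rewrite -{}xy in lt_y eq_y; exists x; split; first exact: ltn_trans lt_y.
      by move=> z zx xz; rewrite eq_x ?eq_y.
    have /orP[xy|yx] := le_tot x y.
      exists y; split=> [|z zy yz]; first by rewrite eq_x // eq_sym.
      rewrite eq_x ?eq_y //; last exact: le_trans yz.
      by apply: contraNneq neq_xy => zx; rewrite (le_anti x y) // xy -zx.
    exists x; split=> [|z zx xz]; first by rewrite -eq_y.
    rewrite eq_x ?eq_y //; last exact: le_trans xz.
    by apply: contraNneq neq_xy => zy; rewrite (le_anti x y) // yx -zy xz.
  + move=> a b; have [->|neq_ab] := eqVneq a b.
      by apply/orP; left; apply/lex_orderP; left.
    have [x [neq_x eq_x]] := largest_difference neq_ab.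
    case: (ltngtP (a x) (b x)) neq_x => // lt_x _; apply/orP; [left|right];
      by apply/lex_orderP; right; exists x; split=> // y yx xy; rewrite eq_x.
- move=> a; apply/lex_orderP; have [->|neq_0a] := eqVneq 0%MM a; first by left.
  have [x [neq_x eq_x]] := largest_difference neq_0a; right; exists x; split=> //.
  by move: neq_x; rewrite mnm0E lt0n eq_sym.
- move=> a b c /lex_orderP[->|[x [lt_x eq_x]]]; apply/lex_orderP; first by left.
  right; exists x; split=> [|y yx xy]; rewrite !mnmDE ?ltn_add2r //.
  by rewrite eq_x.
Qed.

End LexOrder.

Lemma monomial_order_ti (n : nat) (r : rel 'X_{1..n}) :
  monomial_order r -> translation_invariant r.
Proof. by case. Qed.

(** * Linear functionals on convex hulls, and orders refining them *)

Section Weights.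

Variables (R : realType) (n : nat).

Definition dot (w u : 'rV[R]_n) : R := \sum_(k < n) w ord0 k * u ord0 k.

Lemma dot_sum w k (c : 'I_k -> R) (y : 'I_k -> 'rV[R]_n) :
  dot w (\sum_(i < k) c i *: y i) = \sum_(i < k) c i * dot w (y i).
Proof.
rewrite /dot (eq_bigr (fun j => \sum_(i < k) c i * (w ord0 j * y i ord0 j))).
  by rewrite exchange_big; apply: eq_bigr => i _; rewrite mulr_sumr.
move=> j _; rewrite summxE mulr_sumr; apply: eq_bigr => i _.
by rewrite mxE mulrCA.
Qed.

Lemma dot_hull_le (S : 'rV[R]_n -> Prop) w M z :
  (forall y, S y -> dot w y <= M) -> convex_hull S z -> dot w z <= M.
Proof.
move=> SM [k [c [y [c0 c1 Sy ->]]]]; rewrite dot_sum.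
have -> : M = \sum_(i < k) c i * M by rewrite -mulr_suml c1 mul1r.
by apply: ler_sum => i _; rewrite ler_wpM2l // SM.
Qed.

(** A convex combination that reaches the maximum has coefficient zero at every point below it, so
    only copies of [u] contribute. *)
Lemma dot_hull_lt (S : 'rV[R]_n -> Prop) w u z :
    (forall y, S y -> y <> u -> dot w y < dot w u) ->
  convex_hull S z -> z <> u -> dot w z < dot w u.
Proof.
move=> Su [k [c [y [c0 c1 Sy zE]]]] zu.
have Sle i : dot w (y i) <= dot w u.
  by have [->//|/eqP yu] := eqVneq (y i) u; apply/ltW/Su.
rewrite lt_neqAle; apply/andP; split; last first.
  apply: (@dot_hull_le (fun v => dot w v <= dot w u)) => //.
  by exists k, c, y.
apply/eqP=> eq_z; apply: zu; rewrite zE.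
have : \sum_(i < k) c i * (dot w u - dot w (y i)) = 0.
  rewrite (eq_bigr (fun i => c i * dot w u - c i * dot w (y i))) => [|i _].
    by rewrite sumrB -mulr_suml c1 mul1r -dot_sum -zE eq_z subrr.
  by rewrite mulrBr.
move=> /eqP; rewrite psumr_eq0 => [/allP sum0|i _]; last first.
  by rewrite mulr_ge0 // subr_ge0.
rewrite (eq_bigr (fun i => c i *: u)) => [|i _].
  by rewrite -scaler_suml c1 scale1r.
have := sum0 i (mem_index_enum i); rewrite /= mulf_eq0 => /orP[/eqP->|].
  by rewrite !scale0r.
rewrite subr_eq0 => /eqP eq_i; have [->//|/eqP yu] := eqVneq (y i) u.
by have := Su _ (Sy i) yu; rewrite eq_i ltxx.
Qed.

Definition weight (w : 'rV[R]_n) (a : 'X_{1..n}) : R := dot w (expvec R a).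

Lemma weightD w a b : weight w (a + b)%MM = weight w a + weight w b.
Proof.
rewrite /weight /dot -big_split; apply: eq_bigr => k _ /=.
by rewrite !mxE mnmDE natrD mulrDr.
Qed.

Lemma weight0 w : weight w 0%MM = 0.
Proof. by rewrite /weight /dot big1 // => k _; rewrite mxE mnm0E mulr0. Qed.

Lemma weightU w k : weight w U_(k)%MM = w ord0 k.
Proof.
rewrite /weight /dot (bigD1 k) //= big1 => [|l lk]; rewrite mxE mnmE.
  by rewrite eqxx mulr1 addr0.
by rewrite eq_sym (negPf lk) mulr0.
Qed.

(** Ties are broken by the order that ['X_{1..n}] already carries. *)
Definition weight_order (w : 'rV[R]_n) : rel 'X_{1..n} :=
  fun a b => (weight w a < weight w b) ||
    ((weight w a == weight w b) && (a <= b)%O).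

Lemma weight_order_ti w : translation_invariant (weight_order w).
Proof.
rewrite /weight_order; split; last first.
  move=> a b c; rewrite !weightD ltrD2r (inj_eq (addIr _)).
  by rewrite ![(_ + c)%MM]addmC lemc_add2r.
split.
- by move=> a; rewrite eqxx lexx orbT.
- move=> a b; case: (ltgtP (weight w a) (weight w b)) => //= _.
  by move/le_anti.
- move=> b a c /orP[ab|/andP[/eqP-> ab]]; last first.
    by case/orP=> [->//|/andP[-> bc]]; rewrite (le_trans ab bc) orbT.
  by case/orP=> [bc|/andP[/eqP <- _]]; rewrite ?ab // (lt_trans ab bc).
- by move=> a b; case: ltgtP => //= _; apply: le_total.
Qed.

Lemma weight_order_le w a b : weight_order w a b -> weight w a <= weight w b.
Proof. by case/orP=> [/ltW//|/andP[/eqP->]]. Qed.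

End Weights.

(** * The terms of the submaximal minors *)

Definition mvar {m : nat} (i j : 'I_m) : 'X_{1..m * m} :=
  U_(mxvec_index i j)%MM.

Section SubmaximalMinors.

Variables (K : fieldType) (m : nat).
Implicit Types (s t : {perm 'I_m}) (p q i j k : 'I_m).

Notation M := (@submaximal_minor m K).

Lemma mvarE i j k l : mvar i j (mxvec_index k l) = ((i == k) && (j == l)) :> nat.
Proof.
rewrite /mvar mnmE; congr (nat_of_bool _).
rewrite (inj_eq (f := fun c : 'I_m * 'I_m => mxvec_index c.1 c.2) _ (i, j) (k, l)).
  by rewrite xpair_eqE.
apply: (can_inj (g := fun c => enum_val (cast_ord (esym (mxvec_cast m m)) c))).
by case=> a b; rewrite /mxvec_index cast_ordK enum_rankK.
Qed.

Lemma cowt_mvarE p s i j :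
  cowt mvar p s (mxvec_index i j) = ((i != p) && (s i == j)) :> nat.
Proof.
rewrite /cowt mnm_sumE; have [->|ip] /= := eqVneq i p.
  by rewrite big1 // => k kp; rewrite mvarE (negPf kp).
rewrite (bigD1 i) //= big1 => [|k /andP[_ ki]]; rewrite mvarE ?eqxx ?addn0 //.
by rewrite (negPf ki).
Qed.

Lemma cowt_mvar_inj p (s t : 'S_m) :
  s p = t p -> cowt mvar p s = cowt mvar p t -> s = t.
Proof.
move=> stp eq_st; apply/permP=> k; have [->//|kp] := eqVneq k p.
have := cowt_mvarE p s k (s k); rewrite eq_st cowt_mvarE kp eqxx /=.
by case: eqP.
Qed.

(** Up to sign the minor is a cofactor, expanded over the permutations sending [p] to [q]. Their
    monomials are distinct, so nothing cancels, and the coefficients are signs, nonzero in any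
    characteristic. *)
Lemma msupp_submaximal_minor p q a :
  a \in msupp (M (p, q)) <-> exists2 s : 'S_m, s p = q & a = cowt mvar p s.
Proof.
pose c := cofactor (genericX m K) p q.
have cE : c = \sum_(s : 'S_m | s p == q) (-1) ^+ s * 'X_[cowt mvar p s].
  rewrite /c expand_cofactor; apply: eq_bigr => s _; congr (_ * _).
  rewrite /cowt -mprodXE; apply: eq_big => [k|k _]; first by rewrite eq_sym.
  by rewrite mxE.
have suppE : (a \in msupp (M (p, q))) = (a \in msupp c).
  rewrite /c /cofactor !mcoeff_msupp -signr_odd -[\det _]/(M (p, q)).
  by case: (odd _); rewrite ?expr1 ?expr0 ?mul1r // mulN1r mcoeffN oppr_eq0.
have coefE s (d : 'X_{1..m * m}) : ((-1) ^+ s * 'X_[cowt mvar p s])@_d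
    = (-1) ^+ s * (cowt mvar p s == d)%:R :> K.
  by rewrite -mcoeffX; case: (odd_perm s) => /=;
    rewrite ?expr1 ?expr0 ?mulN1r ?mul1r ?mcoeffN.
rewrite suppE mcoeff_msupp cE raddf_sum /=; split=> [sum_neq0|[s sp ->]]; last first.
  rewrite (bigD1 s) /= ?sp // coefE eqxx mulr1 big1 ?addr0 ?signr_eq0 //.
  move=> t /andP[/eqP tp ts]; rewrite coefE; case: eqP => [|_]; last exact: mulr0.
  by move/cowt_mvar_inj => ts'; rewrite ts' ?eqxx // tp in ts.
have [s /andP[/eqP sp coef_neq0]] : exists s, (s p == q) &&
    (((-1) ^+ s * 'X_[cowt mvar p s])@_a != 0 :> K).
  apply/existsP; apply: contraNT sum_neq0; rewrite negb_exists => /forallP all0.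
  rewrite big1 // => s sp; apply/eqP; have := all0 s.
  by rewrite sp negbK.
exists s => //; apply/esym/eqP; apply: contraNT coef_neq0 => /negPf neq_a.
by rewrite coefE neq_a mulr0.
Qed.

End SubmaximalMinors.

(** * Matchings selected by an order and involving all variables *)

Section CoherentMatchings.

Variables (K : fieldType) (m : nat).
Implicit Types (p q i j k : 'I_m).

Notation M := (@submaximal_minor m K).

Lemma initial_submaximal_minor r : translation_invariant r ->
  exists b, forall pq, initial_monomial r (M pq) (b pq).
Proof.
move=> r_inv; have [[r_refl _ r_trans r_total] _] := r_inv.
have ge_refl : reflexive (fun a b => r b a) by move=> x; apply: r_refl.
have ge_trans : transitive (fun a b => r b a).
  by move=> y x z yx zy; apply: r_trans yx.
have ge_total : total (fun a b => r b a) by move=> x y; apply: r_total.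
suff /fin_all_exists[b bP] : forall pq, exists a, initial_monomial r (M pq) a.
  by exists b.
case=> p q.
have tpq : tperm p q p == q by rewrite tpermL.
have [s /eqP sp s_max] := @extremumP _ _ _ (tperm p q) (fun s : 'S_m => s p == q)
  (cowt mvar p) ge_refl ge_trans ge_total tpq.
exists (cowt mvar p s); split; first by apply/msupp_submaximal_minor; exists s.
by move=> b /msupp_submaximal_minor[t /eqP tp ->]; apply: s_max.
Qed.

Lemma full_support_matching r (b : 'I_m * 'I_m -> 'X_{1..m * m}) :
    translation_invariant r ->
    (forall pq, initial_monomial r (M pq) (b pq)) ->
    involves_all_variables b ->
  exists sigma : 'S_m, forall p q,
    b (p, q) = cowt mvar p (tperm p ((sigma^-1)%g q) * sigma)%g.
Proof.
move=> r_inv b_init b_all; have [[r_refl _ r_trans r_total] _] := r_inv.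
have ge_refl : reflexive (fun a b => r b a) by move=> x; apply: r_refl.
have ge_trans : transitive (fun a b => r b a).
  by move=> y x z yx zy; apply: r_trans yx.
have ge_total : total (fun a b => r b a) by move=> x y; apply: r_total.
have [sigma _ sigma_max] := @extremumP _ _ _ (1%g : 'S_m) xpredT (wt mvar)
  ge_refl ge_trans ge_total isT.
have /fin_all_exists[beta betaP] : forall pq : 'I_m * 'I_m, exists s : 'S_m,
    s pq.1 = pq.2 /\ b pq = cowt mvar pq.1 s.
  case=> p q; by have [/msupp_submaximal_minor[s sp bE] _] := b_init (p, q); exists s.
(* Columns are renamed so that the optimal permutation [sigma] becomes the identity; [opt] below is
   the matching read through this renaming. *)
exists sigma; pose x i j := mvar i (sigma j).
have wtE s : wt x s = wt mvar (s * sigma)%g.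
  by apply: eq_bigr => k _; rewrite permM.
have cowtE p s : cowt x p s = cowt mvar p (s * sigma)%g.
  by apply: eq_bigr => k _; rewrite permM.
pose opt p q := (beta (p, sigma q) * sigma^-1)%g.
have cowt_opt p q : cowt x p (opt p q) = b (p, sigma q).
  by rewrite cowtE mulgKV; case: (betaP (p, sigma q)).
have opt_max p (s : 'S_m) : r (cowt x p s) (cowt x p (opt p (s p))).
  have [_ b_max] := b_init (p, sigma (s p)); rewrite cowt_opt; apply: b_max.
  by apply/msupp_submaximal_minor; exists (s * sigma)%g; rewrite ?permM.
have optE p q : opt p q p = q.
  by rewrite permM; have [-> _] := betaP (p, sigma q); rewrite permK.
have opt_tp : forall p q, opt p q = tperm p q.
  apply: (opt_tperm (x := x) r_inv) => //.
  - by move=> s; rewrite !wtE mul1g; apply: sigma_max.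
  (* Distinct terms of a minor are distinct monomials, so antisymmetry of [r] gives uniqueness of
     the optimum. *)
  - move=> p s le; apply: (@mulIg _ sigma); apply: (@cowt_mvar_inj _ p).
      by rewrite [LHS]permM [RHS]permM optE.
    by rewrite -!cowtE; apply: (ti_anti r_inv).
  - move=> i j _; have [[p q]] := b_all (mxvec_index i (sigma j)).
    have [bp ->] := betaP (p, q); rewrite cowt_mvarE lt0b => /andP[ip /eqP bi].
    exists p, ((sigma^-1)%g q); rewrite eq_sym ip; split=> //.
    by rewrite permM permKV bi permK.
move=> p q; rewrite -opt_tp mulgKV permKV.
by case: (betaP (p, q)).
Qed.

End CoherentMatchings.

(** * The diagonal matching, its exponent sum and its column permutations *)

Section StandardMatching.

Variable m : nat.
Implicit Types (p q i j k : 'I_m) (s : 'S_m).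

(* The terms X_qp * prod_(k != p, q) X_kk. *)
Definition std_matching (pq : 'I_m * 'I_m) : 'X_{1..m * m} :=
  cowt mvar pq.1 (tperm pq.1 pq.2).

Lemma tperm_uniq p q s : s p = q ->
  (forall k, k != p -> k != q -> s k = k) -> s = tperm p q.
Proof.
move=> sp s_fix; apply/permP=> k.
case: tpermP => [->//|->|/eqP kp /eqP kq]; last exact: s_fix.
have [pq|neq_pq] := eqVneq q p; first by rewrite pq sp.
apply/eqP/negPn/negP => sqp.
have [sqq|sqq] := eqVneq (s q) q.
  by move: neq_pq; rewrite -(inj_eq (@perm_inj _ s)) sqq sp eqxx.
by have /perm_inj sqq' := s_fix _ sqp sqq; rewrite sqq' eqxx in sqq.
Qed.

(** An off-diagonal [X_ij] occurs at index [(j, i)]; [X_ii] occurs at [(p, p)] for any [p] other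
    than [i], which exists as [m >= 2]. *)
Lemma std_matching_all : (2 <= m)%N -> involves_all_variables std_matching.
Proof.
move=> m_ge2 c; case/mxvec_indexP: c => i j.
have [<-|neq_ij] := eqVneq i j; last first.
  by exists (j, i); rewrite cowt_mvarE neq_ij tpermR eqxx.
have [p ip] : exists p, i != p.
  apply/existsP; apply: contraLR m_ge2; rewrite negb_exists => /forallP all_i.
  rewrite -ltnNge -[m]card_ord ltnS; apply/card_le1P => /= k _ l.
  have := all_i k; have := all_i l; rewrite !negbK => /eqP <- /eqP <-.
  by rewrite !inE eqxx.
by exists (p, p); rewrite cowt_mvarE ip tperm1 perm1 eqxx.
Qed.

(** An off-diagonal [X_ij] occurs only at index [(j, i)], whereas [X_ii] occurs at all [(m - 1) ^ 2]
    indices avoiding row and column [i]. *)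
Lemma sum_std_matching i j : (2 <= m)%N ->
  (\sum_pq std_matching pq (mxvec_index i j))%N = Qmx m i j.
Proof.
move=> m_ge2; rewrite !mxE.
rewrite -(pair_bigA _ (fun p q => std_matching (p, q) (mxvec_index i j))) /=.
have [<-|neq_ij] := eqVneq i j; last first.
  rewrite (bigD1 j) //= (bigD1 i) //= cowt_mvarE neq_ij tpermR eqxx /=.
  rewrite !big1 // => [p pj|q qi].
    rewrite big1 // => q _; rewrite cowt_mvarE /=.
    case: tpermP => [->|->|_ _]; rewrite ?eqxx ?(negPf pj) ?andbF //.
    by rewrite (negPf neq_ij) andbF.
  rewrite cowt_mvarE /=.
  case: tpermP => [->|iq|_ _]; rewrite ?eqxx //; first by rewrite iq eqxx in qi.
  by rewrite (negPf neq_ij) andbF.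
rewrite (bigD1 i) //= big1 => [|q _]; last by rewrite cowt_mvarE eqxx.
rewrite (eq_bigr (fun=> (m - 1)%N)) => [|p pi].
  (* [m >= 2] makes the truncated subtraction in [(m - 1) ^ 2 - 1] exact. *)
  by rewrite sum_nat_const cardC1 card_ord mulr1n /=; nia.
rewrite (bigD1 i) //= cowt_mvarE tpermR (negPf pi) andbF add0n.
rewrite (eq_bigr (fun=> 1%N)) => [|q qi].
  by rewrite sum1_card cardC1 card_ord subn1.
by rewrite cowt_mvarE eq_sym pi tpermD 1?eq_sym ?eqxx // eq_sym.
Qed.

(** The first [1%g] is the zero of ['Z_2], so nothing is transposed. The definition is transparent
    so that [pos_act] computes on it. *)
Definition col_perm_elt s : Gmm m.
Proof. by exists (1%g, (1%g, s)); rewrite !inE. Defined.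

Lemma pos_act_col_permV s pq :
  pos_act m pq (col_perm_elt s)^-1%g = (pq.1, (s^-1)%g pq.2).
Proof.
(* Acting on both sides avoids computing an inverse in the semidirect product. *)
apply: (act_inj (pos_act m) (col_perm_elt s)); rewrite actKV.
by rewrite /= /pos_act_fun /= perm1 permKV; case: pq.
Qed.

End StandardMatching.

Lemma col_perm_matching m (sigma : 'S_m) (b : 'I_m * 'I_m -> 'X_{1..m * m}) :
    (forall p q,
      b (p, q) = cowt mvar p (tperm p ((sigma^-1)%g q) * sigma)%g) ->
  (fun pq => expmx (b pq))
    =1 match_act (fun pq => expmx (std_matching pq)) (col_perm_elt sigma).
Proof.
move=> bE [p q]; apply/matrixP=> i j.
rewrite bE /match_act /mx_act !mxE !pos_act_col_permV /= !cowt_mvarE permM.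
by rewrite (canF_eq (permK sigma)).
Qed.

Lemma sum_col_perm_matching m (sigma : 'S_m)
    (b : 'I_m * 'I_m -> 'X_{1..m * m}) i j : (2 <= m)%N ->
    (forall p q,
      b (p, q) = cowt mvar p (tperm p ((sigma^-1)%g q) * sigma)%g) ->
  (\sum_pq b pq (mxvec_index i j))%N = Qmx m i ((sigma^-1)%g j).
Proof.
move=> m_ge2 bE; rewrite -sum_std_matching //.
rewrite (reindex (fun pq => (pq.1, sigma pq.2))) /=; last first.
  by exists (fun pq => (pq.1, (sigma^-1)%g pq.2)) => -[p q] _ /=;
    rewrite ?permK ?permKV.
apply: eq_bigr => -[p q] _; rewrite bE permK !cowt_mvarE permM /=.
by rewrite (canF_eq (permK sigma)).
Qed.

(** * A weight and lexicographic orders that select the diagonal matching *)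

Section DiagonalWeight.

Variables (R : realType) (K : fieldType) (m : nat).
Notation M := (@submaximal_minor m K).

Definition diag_weight : 'rV[R]_(m * m) := mxvec 1%:M.

Lemma diag_weight_cowt p (s : 'S_m) :
  weight diag_weight (cowt mvar p s) = (\sum_(k | k != p) (s k == k))%:R.
Proof.
rewrite /cowt (big_morph _ (weightD diag_weight) (weight0 _)) natr_sum.
by apply: eq_bigr => k _; rewrite weightU mxvecE mxE eq_sym.
Qed.

(** The weight counts fixed points other than [p]. If [q != p], then [q] cannot be fixed, being the
    value at [p]; so [tperm p q] has as many fixed points as possible, and every competitor moves a
    further point. *)
Lemma std_matching_strict pq :
  strict_initial (fun a b => weight diag_weight a < weight diag_weight b)
    (M pq) (std_matching pq).
Proof.
case: pq => p q; split=> [|b /msupp_submaximal_minor[s sp ->] neq_s].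
  by apply/msupp_submaximal_minor; exists (tperm p q); rewrite ?tpermL.
rewrite !diag_weight_cowt ltr_nat /=.
have le_s k : k != p -> ((s k == k) <= (tperm p q k == k))%N.
  move=> kp; case: tpermP kp => [->|->|_ _ _]; rewrite ?eqxx ?leq_b1 //.
  by rewrite -{3}sp (inj_eq perm_inj) => /negPf ->.
have [k /and3P[kp kq sk]] : exists k, [&& k != p, k != q & s k != k].
  apply/existsP; apply: contraNT neq_s; rewrite negb_exists => /forallP fix_s.
  rewrite /std_matching /= (tperm_uniq sp) // => k kp kq.
  by have := fix_s k; rewrite kp kq /= negbK => /eqP.
rewrite (bigD1 k) // [X in (_ < X)%N](bigD1 k) //= (negPf sk).
rewrite tpermD 1?eq_sym // eqxx ltnS leq_sum // => l /andP[lp _].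
exact: le_s.
Qed.

End DiagonalWeight.

(** Let [k] be the least index outside [p], [q] moved by a competitor. Every variable above [X_kk]
    is some [X_ii] with [i < k]: both terms omit it if [i] is [p] or [q], and both contain it
    otherwise. The competitor lacks [X_kk]. *)
Lemma std_matching_lex (K : fieldType) m (le : rel 'I_(m * m)) pq :
  diagonal_first le ->
  initial_monomial (lex_order le) (submaximal_minor K pq) (std_matching pq).
Proof.
case: pq => p q [le_total le_diag le_off].
have [le_refl le_anti _ _] := le_total.
split=> [|b /msupp_submaximal_minor[s sp ->]].
  by apply/msupp_submaximal_minor; exists (tperm p q); rewrite ?tpermL.
apply/lex_orderP; rewrite /std_matching /=.
have [->|neq_s] := eqVneq s (tperm p q); [by left | right].
have [k0 k0P] : exists k, [&& k != p, k != q & s k != k].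
  apply/existsP; apply: contraNT neq_s; rewrite negb_exists => /forallP fix_s.
  apply/eqP/tperm_uniq => // k kp kq.
  by have := fix_s k; rewrite kp kq /= negbK => /eqP.
have [k /and3P[kp kq sk] k_min] :=
  @arg_minnP _ k0 (fun k => [&& k != p, k != q & s k != k]) val k0P.
exists (mxvec_index k k); rewrite !cowt_mvarE kp (negPf sk) /=.
rewrite tpermD 1?eq_sym // eqxx; split=> // y; case/mxvec_indexP: y => i j.
move=> neq_y le_y; rewrite !cowt_mvarE.
have anti : le (mxvec_index i j) (mxvec_index k k) -> False.
  by move=> le_y'; rewrite (le_anti _ _ (introT andP (conj le_y le_y'))) eqxx in neq_y.
have [ij|neq_ij] := eqVneq i j; last by case: anti; apply: le_off.
rewrite -{j}ij in neq_y le_y anti *.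
have [->//|ip] /= := eqVneq i p; have [iq|iq] := eqVneq i q.
  move: ip; rewrite iq tpermR [p == q]eq_sym => /negPf qp.
  by rewrite qp -{2}sp (inj_eq perm_inj) qp.
rewrite tpermD 1?eq_sym // eqxx; have [//|si] := eqVneq (s i) i.
have := k_min i; rewrite ip iq si => /(_ isT); rewrite leq_eqVlt.
case/orP=> [/eqP/val_inj ki|ki]; first by rewrite ki eqxx in neq_y.
by case: anti; apply: le_diag.
Qed.

(** * Vertices with full support and their matchings *)

Theorem theorem7p5 (R : realType) (K : fieldType) (m : nat)
    (m_ge2 : (2 <= m)%N) :
  let M : 'I_m * 'I_m -> {mpoly K[m * m]} := @submaximal_minor m K in
  let N : 'rV[R]_(m * m) -> Prop := newton_polytope (\prod_p M p) in
  let Q : 'M[R]_m := map_mx (fun k : nat => k%:R) (Qmx m) in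
  [/\ vertex N (mxvec Q),
      full_support Q
    & forall A : 'M[R]_m, vertex N (mxvec A) -> full_support A ->
        exists g : Gmm m, A = mx_act Q g]
  /\
  (forall le : rel 'I_(m * m), diagonal_first le ->
     exists a : 'I_m * 'I_m -> 'X_{1..m * m},
       [/\ forall p, initial_monomial (lex_order le) (M p) (a p),
           coherent M a,
           involves_all_variables a,
           expmx (\big[@mnm_add (m * m)/0%MM]_p a p) = Qmx m
         & forall b : 'I_m * 'I_m -> 'X_{1..m * m},
             coherent M b -> involves_all_variables b ->
             exists g : Gmm m,
               (fun p => expmx (b p)) =1 match_act (fun p => expmx (a p)) g]).
Proof.
move=> M N Q; have sum_std : expmx (\big[mnm_add/0%MM]_p std_matching p) = Qmx m.
  by apply/matrixP=> i j; rewrite mxE mnm_sumE sum_std_matching.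
have N_expvec a : a \in msupp (\prod_p M p) -> N (expvec R a).
  move=> aM; exists 1%N, (fun=> 1), (fun=> expvec R a).
  by split=> [i||i|]; rewrite ?big_ord1 ?scale1r ?ler01 //; exists a.
have expvec_mx (a : 'X_{1..m * m}) (A : 'M[R]_m) :
    (forall i j, A i j = (a (mxvec_index i j))%:R) -> mxvec A = expvec R a.
  move=> aE; apply/rowP=> k; case/mxvec_indexP: k => i j.
  by rewrite mxvecE aE mxE.
split; last first.
  move=> le le_diag; have [le_total _ _] := le_diag.
  have init p := std_matching_lex K p le_diag.
  exists (@std_matching m); split=> //.
  - split; first by move=> p; case: (init p).
    by exists (lex_order le) => //; apply: lex_order_monomial.
  - exact: std_matching_all.
  move=> b [_ [r /monomial_order_ti r_inv b_init]] b_all.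
  have [sigma bE] := full_support_matching r_inv b_init b_all.
  by exists (col_perm_elt sigma); apply: col_perm_matching.
split.
(* The diagonal weight has a unique maximizer in each minor, hence in the support of the product,
   hence in the hull. *)
- pose w := diag_weight R m.
  have [aM a_max] : strict_initial (fun a b => weight w a < weight w b)
      (\prod_p M p) (\big[mnm_add/0%MM]_p std_matching p).
    apply: strict_initial_prod (@std_matching_strict R K m) => [a|b a c|a b c].
    + exact: ltxx.
    + exact: lt_trans.
    + by rewrite !weightD ltrD2r.
  have -> : mxvec Q = expvec R (\big[mnm_add/0%MM]_p std_matching p).
    by apply: expvec_mx => i j; rewrite /Q -sum_std !mxE.
  split; first exact: N_expvec.
  exists w => u uN neq_u; apply: dot_hull_lt uN neq_u => y [b bM ->] neq_b.
  by apply: a_max => //; apply: contra_not_neq neq_b => ->.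
- by move=> i j; rewrite !mxE ltr0n; apply: leq_addl.
move=> A [AN [w w_max]] A_full.
have r_inv := weight_order_ti w.
have [[r_refl r_anti r_trans _] r_add] := r_inv.
have [b b_init] := initial_submaximal_minor K r_inv.
have [bM b_max] : initial_monomial (weight_order w) (\prod_p M p)
    (\big[mnm_add/0%MM]_p b p).
  apply/initial_monomial_strict => //; apply: strict_initial_prod => [a|e a c|a c e|p].
  - by rewrite eqxx.
  - move=> /andP[ae rae] /andP[ec rec]; rewrite (r_trans _ _ _ rae rec) andbT.
    by apply: contraNneq ae => ac; rewrite (ti_anti r_inv rae) // ac.
  - by move=> /andP[ac rac]; rewrite r_add // andbT eqm_add2r.
  - by apply/initial_monomial_strict.
(* The initial monomial of the product has maximal [w]-weight on the support, hence on the hull,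
   where [A] is the only maximizer. *)
have AE : mxvec A = expvec R (\big[mnm_add/0%MM]_p b p).
  apply/eqP/negPn/negP=> /eqP neq_A.
  have := w_max _ (N_expvec _ bM) (fun eq => neq_A (esym eq)).
  rewrite ltNge => /negP; apply; apply: dot_hull_le AN => y [a aM ->].
  exact/weight_order_le/b_max.
have Aij i j : A i j = (\sum_p b p (mxvec_index i j))%N%:R.
  by rewrite -mxvecE AE mxE mnm_sumE.
have b_all : involves_all_variables b.
  move=> k; case/mxvec_indexP: k => i j.
  have := A_full i j; rewrite Aij ltr0n lt0n sum_nat_eq0 negb_forall.
  by case/existsP=> p; rewrite -lt0n => bp; exists p.
have [sigma bE] := full_support_matching r_inv b_init b_all.
exists (col_perm_elt sigma); apply/matrixP=> i j.
rewrite Aij (sum_col_perm_matching _ _ m_ge2 bE) [RHS]mxE.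
by rewrite pos_act_col_permV [RHS]mxE.
Qed.
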